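(* Let $m\ge 4$ and let $\pi$ be a permutation of $\mathbb{F}_2^m$ which has the property $(P_1)$: for all linearly independent $v,w\in\mathbb{F}_2^m$, the function $D_vD_w\pi$ is not the constant zero function. Define $f\colon\mathbb{F}_2^m\times\mathbb{F}_2^m\to\mathbb{F}_2$ by $f(x,y)=x\cdot\pi(y)+\delta_0(x)$ for all $x,y\in\mathbb{F}_2^m$. Then $\operatorname{r-ind}(f)\le 2$. Furthermore, $\operatorname{r-ind}(f)=1$ (which implies $\operatorname{ind}(f)=1$) if and only if no component of $\pi$ has a nonzero linear structure.
   Context: $\cdot$ is the standard scalar product over $\mathbb{F}_2$. $\delta_0(x)=\prod_{i=1}^m(x_i+1)$ is the indicator function of $\{0_m\}$. For a function $F$ on $\mathbb{F}_2^r$ with values in $\mathbb{F}_2^s$: $D_aF(x)=F(x+a)+F(x)$ and $D_aD_bF(x)=F(x+a+b)+F(x+a)+F(x+b)+F(x)$. The components of $\pi$ are the Boolean functions $c\cdot\pi$ for $c\in\mathbb{F}_2^m\setminus\{0_m\}$. A vector $a$ is a linear structure of a Boolean function $g$ if $D_ag$ is constant. For a Boolean function $f$ on $\mathbb{F}_2^n$, a linear subspace $U$ of $\mathbb{F}_2^n$ is an $\mathcal{M}$-subspace of $f$ if $D_aD_bf$ is identically $0$ for all $a,b\in U$, and is a relaxed $\mathcal{M}$-subspace of $f$ if for all $a,b\in U$ the function $D_aD_bf$ is either constant zero or constant one. The linearity index $\operatorname{ind}(f)$ is the maximal dimension of an $\mathcal{M}$-subspace of $f$; the relaxed linearity index $\operatorname{r-ind}(f)$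 is the maximal dimension of a relaxed $\mathcal{M}$-subspace of $f$. *)

(* Defs.v *)
From mathcomp Require Import all_boot all_algebra.
From mathcomp Require Import boolp.

Set Implicit Arguments.
Unset Strict Implicit.
Unset Printing Implicit Defensive.

Import GRing.Theory.
Local Open Scope ring_scope.

(* Only used between vector spaces over 'F_2, where F (x + a) + F x is also
   F (x + a) - F x. *)
Definition derivative (V W : nmodType) (a : V) (F : V -> W) : V -> W :=
  fun x => F (x + a) + F x.

Definition derivative2 (V W : nmodType) (a b : V) (F : V -> W) : V -> W :=
  derivative a (derivative b F).

Definition dot (m : nat) (x y : 'rV['F_2]_m) : 'F_2 :=
  \sum_(i < m) x 0 i * y 0 i.

Definition delta0 (m : nat) (x : 'rV['F_2]_m) : 'F_2 :=
  \prod_(i < m) (x 0 i + 1).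

Definition linear_structure (V : nmodType) (g : V -> 'F_2) (a : V) : Prop :=
  exists e : 'F_2, forall x : V, derivative a g x = e.

Definition component (m : nat) (pi : 'rV['F_2]_m -> 'rV['F_2]_m)
    (c : 'rV['F_2]_m) : 'rV['F_2]_m -> 'F_2 :=
  fun y => dot c (pi y).

Definition property_P1 (m : nat) (pi : 'rV['F_2]_m -> 'rV['F_2]_m) : Prop :=
  forall v w : 'rV['F_2]_m, free [:: v; w] ->
    ~ (forall x : 'rV['F_2]_m, derivative2 v w pi x = 0).

Definition M_subspace (V : vectType 'F_2) (f : V -> 'F_2) (U : {vspace V}) :
    Prop :=
  forall a b : V, a \in U -> b \in U -> forall x : V, derivative2 a b f x = 0.

Definition relaxed_M_subspace (V : vectType 'F_2) (f : V -> 'F_2)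
    (U : {vspace V}) : Prop :=
  forall a b : V, a \in U -> b \in U ->
    (forall x : V, derivative2 a b f x = 0) \/
    (forall x : V, derivative2 a b f x = 1).

(* The largest dimension of a subspace of V satisfying P; the value is 0 when
   no subspace satisfies P, but below the zero subspace always does. *)
Definition max_dim (V : vectType 'F_2) (P : {vspace V} -> Prop) : nat :=
  \max_(k < (\dim {:V}).+1 |
        `[< exists U : {vspace V}, P U /\ \dim U = k >]) k.

Definition ind (V : vectType 'F_2) (f : V -> 'F_2) : nat :=
  max_dim (M_subspace f).

Definition r_ind (V : vectType 'F_2) (f : V -> 'F_2) : nat :=
  max_dim (relaxed_M_subspace f).

Definition MM_delta0 (m : nat) (pi : 'rV['F_2]_m -> 'rV['F_2]_m) :
    'rV['F_2]_m * 'rV['F_2]_m -> 'F_2 :=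
  fun z => dot z.1 (pi z.2) + delta0 z.1.

(* Main.v *)
Require Import Defs.
From mathcomp Require Import all_boot all_algebra all_fingroup.
From mathcomp Require Import boolp ring.

Set Implicit Arguments.
Unset Strict Implicit.
Unset Printing Implicit Defensive.

Import GRing.Theory.
Local Open Scope ring_scope.

(** For [u = (u1, u2)] and [v = (v1, v2)] the second derivative of [f] at
    [(x, y)] is
      x . D_u2 D_v2 pi (y) + u1 . D_v2 pi (y + u2) + v1 . D_u2 pi (y + v2)
        + D_u1 D_v1 delta_0 (x)
    (lemma [derivative2_MM_delta0]), so for fixed [y] it is an affine function
    of [x] plus the second derivative of [delta_0].  If [u1] and [v1] are
    independent, the latter is the indicator of the plane [<u1, v1>], which is
    not affine when [m >= 4] ([derivative2_delta0_not_affine]); if they are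
    dependent, it vanishes.  Hence, if the second derivative is constant, [u1]
    and [v1] are dependent; the coefficient [D_u2 D_v2 pi] of [x] must then be
    zero, and property (P_1) makes [u2] and [v2] dependent as well
    ([constant_derivative2_dependent]).

    So both coordinate projections of a relaxed M-subspace [U] are at most
    one-dimensional, say contained in [<c>] and [<a>], and [U] lies in the span
    of [(c, 0)] and [(0, a)]: its dimension is at most 2.  In dimension 2 it is
    this span, with [c] and [a] nonzero, and the second derivative in these two
    directions, which is [c . D_a pi], is constant: [a] is a linear structure
    of the component [c . pi].  Conversely every such pair [c], [a] gives a
    relaxed M-subspace of dimension 2.  Finally, all lines are M-subspaces, so
    both indices are at least 1. *)

(** * Dependence and second derivatives in characteristic 2 *)

Lemma F2_cases (k : 'F_2) : k = 0 \/ k = 1.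
Proof.
by case: k => [[|[|k]] i]; [left; apply: val_inj | right; apply: val_inj |].
Qed.

Lemma addvv_F2 (V : lmodType 'F_2) (v : V) : v + v = 0.
Proof.
have -> : v + v = (1 + 1 : 'F_2) *: v by rewrite scalerDl scale1r.
have -> : 1 + 1 = 0 :> 'F_2 by apply: val_inj.
by rewrite scale0r.
Qed.

Lemma addrr_F2 (k : 'F_2) : k + k = 0.
Proof. by case: (F2_cases k) => ->; apply: val_inj. Qed.

Lemma vline_F2 {V : vectType 'F_2} {u v : V} : u \in <[v]>%VS -> u = 0 \/ u = v.
Proof.
case/vlineP => k ->; case: (F2_cases k) => ->.
  by left; rewrite scale0r.
by right; rewrite scale1r.
Qed.

Lemma not_free_pair_F2 {V : vectType 'F_2} {u v : V} :
  ~~ free [:: u; v] -> [\/ u = 0, v = 0 | u = v].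
Proof.
rewrite free_cons span_seq1 seq1_free negb_and !negbK.
case/orP => [/vline_F2 [] -> | /eqP ->].
- by constructor 1.
- by constructor 3.
- by constructor 2.
Qed.

Lemma vline_not_free {V : vectType 'F_2} {u v c : V} :
  u \in <[c]>%VS -> v \in <[c]>%VS -> ~~ free [:: u; v].
Proof.
move=> /vline_F2 Hu /vline_F2 Hv; rewrite free_cons span_seq1 seq1_free.
case: Hu => ->; first by rewrite mem0v.
by case: Hv => ->; rewrite ?memv_line ?eqxx ?andbF.
Qed.

(** Over [F_2] dependence of [a] and [b] means [a = 0], [b = 0] or [a = b], and
    in each case the four points [x], [x + a], [x + b], [x + a + b] coincide in
    pairs. *)
Lemma derivative2_dependent (V : vectType 'F_2) (W : nmodType) (F : V -> W)
    (addWW : forall w : W, w + w = 0) {a b : V} (x : V) :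
  ~~ free [:: a; b] -> derivative2 a b F x = 0.
Proof.
rewrite /derivative2 /derivative => /not_free_pair_F2 [] ->.
- by rewrite addr0 addWW.
- by rewrite !addr0 !addWW.
- by rewrite -[x + b + b]addrA addvv_F2 addr0 [F x + _]addrC addWW.
Qed.

(** Over [F_2] a vector dependent on a nonzero [c] is 0 or [c], so any nonzero
    value of [f] on [U] spans all the others. *)
Lemma pairwise_dependent_vline (T V : vectType 'F_2) (f : T -> V)
    (U : {vspace T}) :
  (forall u v, u \in U -> v \in U -> ~~ free [:: f u; f v]) ->
  exists c : V, forall u, u \in U -> f u \in <[c]>%VS.
Proof.
move=> Hdep.
case: (pselect (exists2 u, u \in U & f u != 0)) => [[w Uw nz_fw]|H].
  exists (f w) => u Uu; case: (not_free_pair_F2 (Hdep u w Uu Uw)) => fu.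
  - by rewrite fu mem0v.
  - by rewrite fu eqxx in nz_fw.
  - by rewrite fu memv_line.
exists 0 => u Uu; case: (eqVneq (f u) 0) => [->|nz_fu]; first exact: mem0v.
by case: H; exists u.
Qed.

(** * Largest dimensions *)

Section MaxDim.

Variables (V : vectType 'F_2) (P : {vspace V} -> Prop).

Lemma max_dim_leq (n : nat) :
  (forall U, P U -> (\dim U <= n)%N) -> (max_dim P <= n)%N.
Proof. by move=> H; apply/bigmax_leqP => k /asboolP [U [PU <-]]; apply: H. Qed.

Lemma leq_max_dim (U : {vspace V}) : P U -> (\dim U <= max_dim P)%N.
Proof.
move=> PU; have ltU : (\dim U < (\dim {:V}).+1)%N by rewrite ltnS dimvS ?subvf.
rewrite /max_dim; apply: (leq_bigmax_cond (Ordinal ltU)).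
by apply/asboolP; exists U.
Qed.

End MaxDim.

Lemma ind_leq_r_ind (V : vectType 'F_2) (f : V -> 'F_2) : (ind f <= r_ind f)%N.
Proof.
apply: max_dim_leq => U MU; apply: leq_max_dim => a b Ua Ub.
by left; apply: MU.
Qed.

(** Lines are M-subspaces: two vectors on a line are dependent. *)
Lemma ind_gt0 (V : vectType 'F_2) (f : V -> 'F_2) :
  (0 < \dim {:V})%N -> (0 < ind f)%N.
Proof.
rewrite lt0n dimv_eq0 -vpick0; set v := vpick _ => nz_v.
have -> : (0 < ind f)%N = (\dim <[v]> <= ind f)%N by rewrite dim_vline nz_v.
apply: leq_max_dim => a b va vb x.
exact: (derivative2_dependent _ addrr_F2 _ (vline_not_free va vb)).
Qed.

(** * Second derivatives of the two summands *)

Lemma dotDl m (x x' y : 'rV['F_2]_m) : dot (x + x') y = dot x y + dot x' y.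
Proof.
by rewrite /dot -big_split; apply: eq_bigr => i _; rewrite mxE mulrDl.
Qed.

Lemma dotDr m (x y y' : 'rV['F_2]_m) : dot x (y + y') = dot x y + dot x y'.
Proof.
by rewrite /dot -big_split; apply: eq_bigr => i _; rewrite mxE mulrDr.
Qed.

Lemma dot0l m (y : 'rV['F_2]_m) : dot 0 y = 0.
Proof. by rewrite /dot big1 // => i _; rewrite mxE mul0r. Qed.

Lemma dot0r m (x : 'rV['F_2]_m) : dot x 0 = 0.
Proof. by rewrite /dot big1 // => i _; rewrite mxE mulr0. Qed.

(** Unit vectors as [x] read off the entries of [y]. *)
Lemma dot_nondegenerate m (y : 'rV['F_2]_m) :
  (forall x, dot x y = 0) -> y = 0.
Proof.
move=> H; apply/rowP => i; rewrite mxE -[RHS](H (delta_mx 0 i)) /dot.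
rewrite (bigD1 i) //= big1 ?addr0 => [|j ne_ji]; rewrite mxE !eqxx ?mul1r //.
by rewrite (negPf ne_ji) mul0r.
Qed.

Lemma delta0E m (x : 'rV['F_2]_m) : delta0 x = (x == 0)%:R.
Proof.
case: eqP => [->|/eqP nz_x].
  by rewrite /delta0 big1 // => i _; rewrite mxE add0r.
have /rV0Pn [i nz_xi] := nz_x.
rewrite /delta0 (bigD1 i) //=; case: (F2_cases (x 0 i)) nz_xi => -> //.
by rewrite addrr_F2 mul0r.
Qed.

Lemma derivative2_delta0_notin m (a b p : 'rV['F_2]_m) :
  p \notin <<[:: a; b]>>%VS -> derivative2 a b (@delta0 m) p = 0.
Proof.
move=> pNab; have shift w : w \in <<[:: a; b]>>%VS -> delta0 (p + w) = 0.
  move=> abw; rewrite delta0E; case: eqP => // pw0; case/negP: pNab.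
  by rewrite -[p]addr0 -(addvv_F2 w) addrA pw0 add0r.
have aS : a \in <<[:: a; b]>>%VS by rewrite memv_span ?mem_head.
have bS : b \in <<[:: a; b]>>%VS by rewrite memv_span ?in_cons ?eqxx ?orbT.
rewrite /derivative2 /derivative -[p + a + b]addrA.
have -> : delta0 p = 0 by rewrite -[p]addr0 shift ?mem0v.
by rewrite !shift ?memvD // !addr0.
Qed.

Lemma derivative2_delta0_0 m (a b : 'rV['F_2]_m) :
  free [:: a; b] -> derivative2 a b (@delta0 m) 0 = 1.
Proof.
rewrite free_cons span_seq1 seq1_free => /andP [aNb nz_b].
have nz_a : a != 0 by apply: contraNneq aNb => ->; apply: mem0v.
have nz_ab : a + b != 0.
  apply: contraNneq aNb => ab0.
  by rewrite -[a]addr0 -(addvv_F2 b) addrA ab0 add0r memv_line.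
rewrite /derivative2 /derivative !add0r !delta0E eqxx.
by rewrite (negPf nz_a) (negPf nz_b) (negPf nz_ab) !add0r.
Qed.

Lemma exists_notin_span {m : nat} (s : seq 'rV['F_2]_m) :
  (size s < m)%N -> exists p, p \notin <<s>>%VS.
Proof.
move=> lt_sm; have /subvPn [p _ pNs] : ~~ ({:'rV['F_2]_m} <= <<s>>)%VS.
  apply/negP => /dimvS; rewrite dimvf /dim /= mul1n leqNgt.
  by rewrite (leq_ltn_trans (dim_span s) lt_sm).
by exists p.
Qed.

(** The second derivative is the indicator of the plane spanned by [a] and
    [b].  If it differed from a linear form [t] by a constant, that constant
    would be 1, so [t] would be 1 off the plane; but when the codimension is at
    least 2 there are [p] and [q] such that [p], [q] and [p + q] are all off
    the plane. *)
Lemma derivative2_delta0_not_affine m (a b t : 'rV['F_2]_m) (e : 'F_2) :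
  (4 <= m)%N -> free [:: a; b] ->
  ~ (forall x, dot x t + derivative2 a b (@delta0 m) x = e).
Proof.
move=> m_ge4 free_ab Haff.
have e1 : e = 1 by rewrite -(Haff 0) dot0l add0r derivative2_delta0_0.
have off x : x \notin <<[:: a; b]>>%VS -> dot x t = 1.
  by move=> xN; rewrite -e1 -(Haff x) derivative2_delta0_notin ?addr0.
have [p pN] := @exists_notin_span m [:: a; b] (ltnW m_ge4).
have [q qN] := @exists_notin_span m [:: p; a; b] m_ge4.
have subS : (<<[:: a; b]>> <= <<[:: p; a; b]>>)%VS.
  by rewrite [X in (_ <= X)%VS]span_cons addvSr.
have pS : p \in <<[:: p; a; b]>>%VS by rewrite memv_span ?mem_head.
have pqN : p + q \notin <<[:: a; b]>>%VS.
  by apply: contra qN => /(subvP subS); rewrite rpredDl.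
have qN' : q \notin <<[:: a; b]>>%VS by apply: contra qN => /(subvP subS).
by have := off _ pqN; rewrite dotDl !off.
Qed.

(** * Constant second derivatives of the function *)

Section MaioranaMcFarland.

Variables (m : nat) (pi : 'rV['F_2]_m -> 'rV['F_2]_m).
Implicit Types u v z : ('rV['F_2]_m * 'rV['F_2]_m)%type.

Lemma derivative2_MM_delta0 u v z :
  derivative2 u v (MM_delta0 pi) z =
    dot z.1 (derivative2 u.2 v.2 pi z.2)
    + (dot u.1 (derivative v.2 pi (z.2 + u.2))
       + dot v.1 (derivative u.2 pi (z.2 + v.2)))
    + derivative2 u.1 v.1 (@delta0 m) z.1.
Proof.
rewrite /derivative2 /derivative /MM_delta0 /= !dotDl !dotDr.
by rewrite (addrAC z.2 v.2 u.2); ring.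
Qed.

(** With [y] fixed, constancy makes the sum of a linear form in [x], namely
    [x . D_u2 D_v2 pi (y)], and of [D_u1 D_v1 delta_0] constant in [x].  So
    [u1] and [v1] are dependent, the second term vanishes, and the linear form,
    being constant, is zero: [D_u2 D_v2 pi] vanishes, which the property (P_1)
    forbids for independent [u2] and [v2]. *)
Lemma constant_derivative2_dependent u v (e : 'F_2) :
  (4 <= m)%N -> property_P1 pi ->
  (forall z, derivative2 u v (MM_delta0 pi) z = e) ->
  ~~ free [:: u.1; v.1] /\ ~~ free [:: u.2; v.2].
Proof.
move=> m_ge4 P1 Huv.
pose K y := dot u.1 (derivative v.2 pi (y + u.2))
            + dot v.1 (derivative u.2 pi (y + v.2)).
have Hxy x y : dot x (derivative2 u.2 v.2 pi y)
    + derivative2 u.1 v.1 (@delta0 m) x = e - K y.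
  by rewrite -(Huv (x, y)) derivative2_MM_delta0 /=; rewrite /K; ring.
have dep1 : ~~ free [:: u.1; v.1].
  apply/negP => /(derivative2_delta0_not_affine m_ge4); apply.
  exact: (Hxy^~ 0).
split=> //; apply/negP => /P1; apply=> y; apply: dot_nondegenerate => x.
have Hx w : dot w (derivative2 u.2 v.2 pi y) = e - K y.
  by rewrite -(Hxy w y) (derivative2_dependent _ addrr_F2) ?addr0.
by rewrite Hx -(Hx 0) dot0l.
Qed.

Definition axes (c a : 'rV['F_2]_m) : seq ('rV['F_2]_m * 'rV['F_2]_m) :=
  [:: (c, 0); (0, a)].

Lemma relaxed_M_subspace_span U :
  (4 <= m)%N -> property_P1 pi -> relaxed_M_subspace (MM_delta0 pi) U ->
  exists c a, (U <= <<axes c a>>)%VS.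
Proof.
move=> m_ge4 P1 RU.
have dep u v : u \in U -> v \in U ->
    ~~ free [:: u.1; v.1] /\ ~~ free [:: u.2; v.2].
  by move=> Uu Uv; case: (RU u v Uu Uv); apply: constant_derivative2_dependent.
have [|c Hc] := @pairwise_dependent_vline _ _ fst U.
  by move=> u v Uu Uv; case: (dep u v Uu Uv).
have [|a Ha] := @pairwise_dependent_vline _ _ snd U.
  by move=> u v Uu Uv; case: (dep u v Uu Uv).
exists c, a; apply/subvP => z Uz.
have -> : z = (z.1, 0) + (0, z.2).
  by case: z {Uz} => x y; congr pair; rewrite ?addr0 ?add0r.
rewrite span_cons span_seq1; apply: memv_add.
  by case: (vline_F2 (Hc z Uz)) => ->; rewrite ?memv_line ?mem0v.
by case: (vline_F2 (Ha z Uz)) => ->; rewrite ?memv_line ?mem0v.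
Qed.

Lemma relaxed_M_subspace_dim_leq2 U :
  (4 <= m)%N -> property_P1 pi -> relaxed_M_subspace (MM_delta0 pi) U ->
  (\dim U <= 2)%N.
Proof.
move=> m_ge4 P1 /(relaxed_M_subspace_span m_ge4 P1) [c [a sU]].
exact: leq_trans (dimvS sU) (dim_span _).
Qed.

(** By dimension [U] is the whole span of [(c, 0)] and [(0, a)], so it contains
    these two vectors, whose second derivative is [c . D_a pi]. *)
Lemma relaxed_M_subspace_dim2_linear_structure U :
  (4 <= m)%N -> property_P1 pi -> relaxed_M_subspace (MM_delta0 pi) U ->
  \dim U = 2%N ->
  exists c a, [/\ c != 0, a != 0 & linear_structure (component pi c) a].
Proof.
move=> m_ge4 P1 RU dimU.
have [c [a sU]] := relaxed_M_subspace_span m_ge4 P1 RU.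
have dimS : \dim <<axes c a>> = 2%N.
  by apply/eqP; rewrite eqn_leq dim_span -{1}dimU dimvS.
have eqU : U = <<axes c a>>%VS.
  by apply/eqP; rewrite eqEdim sU dimS dimU.
have fS : free (axes c a) by rewrite /free dimS.
exists c, a; split.
- by apply/eqP => c0; move: fS; rewrite free_cons c0 mem0v.
- by apply/eqP => a0; move: fS; rewrite free_cons seq1_free a0 eqxx andbF.
have Uc : (c, 0) \in U by rewrite eqU memv_span ?mem_head.
have Ua : (0, a) \in U by rewrite eqU memv_span ?in_cons ?eqxx ?orbT.
have [e He] :
    exists e, forall z, derivative2 (c, 0) (0, a) (MM_delta0 pi) z = e.
  by case: (RU _ _ Uc Ua); [exists 0 | exists 1].
exists e => y; rewrite -(He (0, y)) derivative2_MM_delta0 /= !dot0l.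
rewrite (derivative2_dependent _ addrr_F2) ?addr0; last first.
  by apply: (@vline_not_free _ c 0 c); rewrite ?mem0v ?memv_line.
by rewrite /derivative /component dotDr add0r ?addr0.
Qed.

(** The span of [(c, 0)] and [(0, a)] is a relaxed M-subspace: both coordinate
    projections are lines, so only the mixed terms of the second derivative
    survive, and these are multiples of [c . D_a pi]. *)
Lemma linear_structure_r_ind_geq2 (c a : 'rV['F_2]_m) :
  c != 0 -> a != 0 -> linear_structure (component pi c) a ->
  (2 <= r_ind (MM_delta0 pi))%N.
Proof.
move=> nz_c nz_a [e He].
pose U := <<axes c a>>%VS.
have dimU : \dim U = 2%N.
  apply/eqP; rewrite -/(free [:: _; _]) free_cons span_seq1 seq1_free.
  rewrite -pair_eqE /= eqxx nz_a andbT.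
  apply/negP => /vline_F2 [] /(congr1 fst) /= c0;
    by rewrite c0 eqxx in nz_c.
have memU u : u \in U -> u.1 \in <[c]>%VS /\ u.2 \in <[a]>%VS.
  rewrite /U span_cons span_seq1.
  move=> /memv_addP [_ /vlineP [k ->] [_ /vlineP [l ->] ->]] /=.
  by rewrite !scaler0 addr0 add0r !memvZ ?memv_line.
have mixed x w : x \in <[c]>%VS -> w \in <[a]>%VS ->
    exists k, forall y, dot x (derivative w pi y) = k.
  move=> /vline_F2 [] -> /vline_F2 [] ->.
  - by exists 0 => y; rewrite dot0l.
  - by exists 0 => y; rewrite dot0l.
  - by exists 0 => y; rewrite /derivative addr0 addvv_F2 dot0r.
  - by exists e => y; rewrite -(He y) /derivative dotDr.
rewrite -[X in (X <= _)%N]dimU.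
apply: leq_max_dim => u v /memU [u1 u2] /memU [v1 v2].
have [k Hk] := mixed _ _ u1 v2; have [l Hl] := mixed _ _ v1 u2.
have Huv z : derivative2 u v (MM_delta0 pi) z = k + l.
  rewrite derivative2_MM_delta0 Hk Hl.
  rewrite (derivative2_dependent _ addrr_F2) ?(vline_not_free u1 v1) //.
  rewrite (derivative2_dependent _ (@addvv_F2 _)) ?(vline_not_free u2 v2) //.
  by rewrite dot0r add0r addr0.
by case: (F2_cases (k + l)) => kl; [left | right] => z; rewrite Huv kl.
Qed.

End MaioranaMcFarland.

Unset Implicit Arguments.

Theorem theorem6p5 (m : nat) (pi : {perm 'rV['F_2]_m})
    (hm : (4 <= m)%N) (hP1 : property_P1 pi) :
  [/\ (r_ind (MM_delta0 pi) <= 2)%N,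
      r_ind (MM_delta0 pi) = 1%N -> ind (MM_delta0 pi) = 1%N
    & r_ind (MM_delta0 pi) = 1%N <->
      ~ (exists c a : 'rV['F_2]_m,
           [/\ c != 0, a != 0 & linear_structure (component pi c) a])].
Proof.
have ind1 : (0 < ind (MM_delta0 pi))%N.
  apply: ind_gt0; rewrite dimvf /dim /= addn_gt0 /dim /= mul1n.
  by rewrite (leq_trans _ hm).
have r_ind1 := leq_trans ind1 (ind_leq_r_ind (MM_delta0 pi)).
split.
- by apply: max_dim_leq => U; apply: relaxed_M_subspace_dim_leq2.
- move=> r1; apply/eqP; rewrite eqn_leq ind1 andbT.
  by rewrite -[X in (_ <= X)%N]r1 ind_leq_r_ind.
split=> [r1 [c [a [nz_c nz_a La]]]|noLS].
  by have := linear_structure_r_ind_geq2 nz_c nz_a La; rewrite r1.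
apply/eqP; rewrite eqn_leq r_ind1 andbT; apply: max_dim_leq => U RU.
rewrite leqNgt; apply/negP => dimU_gt1; apply: noLS.
apply: (relaxed_M_subspace_dim2_linear_structure hm hP1 RU).
by apply/eqP; rewrite eqn_leq dimU_gt1 (relaxed_M_subspace_dim_leq2 hm hP1 RU).
Qed.
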